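(* The category $\text{Sem-inv-}\mathfrak{SA}$ of semilattice inverse systems of Stone spaces and the category $\mathfrak{IBSL}$ of involutive bisemilattices are dually equivalent.
   Context: Conventions: two categories $\mathfrak{C},\mathfrak{D}$ are called equivalent if there are covariant functors $\mathcal F:\mathfrak C\to\mathfrak D$, $\mathcal G:\mathfrak D\to\mathfrak C$ with $\mathcal G\circ\mathcal F=\mathrm{id}_{\mathfrak C}$ and $\mathcal F\circ\mathcal G=\mathrm{id}_{\mathfrak D}$; they are dually equivalent if the same holds with contravariant functors. $\mathfrak{SA}$ is the category of Stone spaces (compact, Hausdorff, totally disconnected topological spaces) with continuous maps. A semilattice homomorphism is a map between join semilattices preserving $\vee$. A semilattice inverse system in a category $\mathfrak C$ is a triple $\langle X_i,p_{ii'},I\rangle$ where $I$ is a join semilattice with a least element, $X_i$ is an object of $\mathfrak C$ for each $i\in I$, and for each $i\le i'$ there is a morphism $p_{ii'}:X_{i'}\to X_i$ with $p_{ii}=\mathrm{id}_{X_i}$ and $p_{ii'}\circ p_{i'i''}=p_{ii''}$ whenever $i\le i'\le i''$. A morphism from $\langle X_i,p_{ii'},I\rangle$ to $\langle Y_j,q_{jj'},J\rangle$ is a pair $(\varphi,(f_j)_{j\in J})$ where $\varphi:J\to I$ is a semilattice homomorphism and $f_j:X_{\varphi(j)}\to Y_j$ are morphisms of $\mathfrak C$ such that $f_j\circ p_{\varphi(j)\varphi(j')}=q_{jj'}\circ f_{j'}$ whenever $j\le j'$. The composite of $(\varphi,(f_j)):\mathcal X\to\mathcal Y$ and $(\psi,(g_k)):\mathcal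 Y\to\mathcal Z$ is $(\varphi\circ\psi,(g_k\circ f_{\psi(k)})_k)$, and the identity is $(\mathrm{id}_I,(\mathrm{id}_{X_i})_i)$. $\text{Sem-inv-}\mathfrak C$ is the resulting category. An involutive bisemilattice is an algebra $\langle B,\cdot,+,{}',0,1\rangle$ of type $(2,2,1,0,0)$ satisfying: $x+x\approx x$; $x+y\approx y+x$; $x+(y+z)\approx(x+y)+z$; $(x')'\approx x$; $x\cdot y\approx(x'+y')'$; $x\cdot(x'+y)\approx x\cdot y$; $0+x\approx x$; $1\approx 0'$. $\mathfrak{IBSL}$ is the category of involutive bisemilattices with their homomorphisms.
   Formalization: Semilattice homomorphisms between index semilattices are also required to preserve the least element (with ∨ alone the claim fails: no terminal object), and ''G∘F = id, F∘G = id'' is read as natural isomorphism to the identity functors. *)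

(* Defs.v *)
From HB Require Import structures.
From mathcomp Require Import all_boot all_order.
From mathcomp Require Import boolp classical_sets.
From mathcomp Require Import topology.

Set Implicit Arguments.
Unset Strict Implicit.
Unset Printing Implicit Defensive.

Import Order.TTheory.

Record category := Category {
  obj :> Type;
  hom : obj -> obj -> Type;
  idm : forall X, hom X X;
  comp : forall X Y Z, hom Y Z -> hom X Y -> hom X Z;
  compIm : forall X Y (f : hom X Y), comp (idm Y) f = f;
  compmI : forall X Y (f : hom X Y), comp f (idm X) = f;
  compA : forall W X Y Z (h : hom Y Z) (g : hom X Y) (f : hom W X),
    comp h (comp g f) = comp (comp h g) f
}.
Arguments idm {c} X.
Arguments comp {c X Y Z} g f.

Declare Scope cat_scope.
Delimit Scope cat_scope with cat.
Notation "g \oc f" := (comp g f) (at level 40, left associativity) : cat_scope.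
Local Open Scope cat_scope.

Record functor (C D : category) := Functor {
  fobj :> C -> D;
  fmap : forall X Y : C, hom X Y -> hom (fobj X) (fobj Y);
  fmap_id : forall X, fmap (idm X) = idm (fobj X);
  fmap_comp : forall X Y Z (g : hom Y Z) (f : hom X Y),
    fmap (g \oc f) = fmap g \oc fmap f
}.

Record cofunctor (C D : category) := Cofunctor {
  cobj :> C -> D;
  cmap : forall X Y : C, hom X Y -> hom (cobj Y) (cobj X);
  cmap_id : forall X, cmap (idm X) = idm (cobj X);
  cmap_comp : forall X Y Z (g : hom Y Z) (f : hom X Y),
    cmap (g \oc f) = cmap f \oc cmap g
}.

Definition functor_id (C : category) : functor C C :=
  @Functor C C id (fun X Y f => f) (fun X => erefl) (fun X Y Z g f => erefl).

Section CofunctorComp.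
Variables (C D E : category) (G : cofunctor D E) (F : cofunctor C D).

Let cc_map (X Y : C) (f : hom X Y) : hom (G (F X)) (G (F Y)) :=
  cmap G (cmap F f).

Lemma cofunctor_comp_id (X : C) : cc_map (idm X) = idm (G (F X)).
Proof. by rewrite /cc_map !cmap_id. Qed.

Lemma cofunctor_comp_comp (X Y Z : C) (g : hom Y Z) (f : hom X Y) :
  cc_map (g \oc f) = cc_map g \oc cc_map f.
Proof. by rewrite /cc_map !cmap_comp. Qed.

Definition cofunctor_comp : functor C E :=
  Functor cofunctor_comp_id cofunctor_comp_comp.

End CofunctorComp.

Record natural_iso (C D : category) (F G : functor C D) := NaturalIso {
  ni_fwd : forall X : C, hom (F X) (G X);
  ni_bwd : forall X : C, hom (G X) (F X);
  ni_fwdK : forall X, ni_bwd X \oc ni_fwd X = idm (F X);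
  ni_bwdK : forall X, ni_fwd X \oc ni_bwd X = idm (G X);
  ni_natural : forall (X Y : C) (f : hom X Y),
    ni_fwd Y \oc fmap F f = fmap G f \oc ni_fwd X
}.

(* Functors are identified up to natural isomorphism: Leibniz equality of     *)
(* their actions on objects would compare carrier types, and not even Stone   *)
(* duality satisfies it.                                                      *)
Definition functor_eq (C D : category) (F G : functor C D) : Prop :=
  inhabited (natural_iso F G).

Definition dually_equivalent (C D : category) : Prop :=
  exists (F : cofunctor C D) (G : cofunctor D C),
    functor_eq (cofunctor_comp G F) (functor_id C) /\
    functor_eq (cofunctor_comp F G) (functor_id D).

Record stoneSpace := StoneSpace {
  stone_sort :> topologicalType;
  stone_compact : compact [set: stone_sort];
  stone_hausdorff : hausdorff_space stone_sort;
  stone_disconnected : totally_disconnected [set: stone_sort]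
}.

Section StoneCat.

Definition stone_id (X : stoneSpace) : continuousType X X := idfun.

Definition stone_comp (X Y Z : stoneSpace)
    (g : continuousType Y Z) (f : continuousType X Y) : continuousType X Z :=
  g \o f.

Lemma stone_compIm (X Y : stoneSpace) (f : continuousType X Y) :
  stone_comp (stone_id Y) f = f.
Proof. exact/continuousEP. Qed.

Lemma stone_compmI (X Y : stoneSpace) (f : continuousType X Y) :
  stone_comp f (stone_id X) = f.
Proof. exact/continuousEP. Qed.

Lemma stone_compA (W X Y Z : stoneSpace) (h : continuousType Y Z)
    (g : continuousType X Y) (f : continuousType W X) :
  stone_comp h (stone_comp g f) = stone_comp (stone_comp h g) f.
Proof. exact/continuousEP. Qed.

Definition SA : category :=
  @Category stoneSpace (fun X Y => continuousType X Y)
    stone_id stone_comp stone_compIm stone_compmI stone_compA.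

End StoneCat.

(* The display of an ordered type carries no information; [Disp tt tt] is the *)
(* default one.                                                               *)
Notation bsemilattice := (bJoinSemilatticeType (Order.Disp tt tt)).

(* Preservation of the empty join is included. It is needed for the duality:  *)
(* homomorphisms of involutive bisemilattices preserve the constant 0.        *)
Record semilattice_hom (J I : bsemilattice) := SemilatticeHom {
  sl_fun :> J -> I;
  sl_join : forall j j', sl_fun (j `|` j')%O = (sl_fun j `|` sl_fun j')%O;
  sl_bot : sl_fun \bot%O = \bot%O
}.

Lemma sl_homo (J I : bsemilattice) (phi : semilattice_hom J I) (j j' : J) :
  (j <= j')%O -> (phi j <= phi j')%O.
Proof. by rewrite !leEjoin -sl_join => /eqP ->. Qed.

Definition sl_id (I : bsemilattice) : semilattice_hom I I :=
  @SemilatticeHom I I id (fun _ _ => erefl) erefl.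

Section SlComp.
Variables (K J I : bsemilattice).
Variables (phi : semilattice_hom J I) (psi : semilattice_hom K J).

Lemma sl_comp_join (k k' : K) :
  (phi \o psi) (k `|` k')%O = ((phi \o psi) k `|` (phi \o psi) k')%O.
Proof. by rewrite /= !sl_join. Qed.

Lemma sl_comp_bot : (phi \o psi) \bot%O = \bot%O.
Proof. by rewrite /= !sl_bot. Qed.

Definition sl_comp : semilattice_hom K I :=
  SemilatticeHom sl_comp_join sl_comp_bot.

End SlComp.

Record inverse_system (C : category) := InverseSystem {
  is_index : bsemilattice;
  is_obj :> is_index -> C;
  is_map : forall i i' : is_index, (i <= i')%O -> hom (is_obj i') (is_obj i);
  is_map_id : forall (i : is_index) (le_ii : (i <= i)%O),
    is_map le_ii = idm (is_obj i);
  is_map_comp : forall (i i' i'' : is_index)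
    (le1 : (i <= i')%O) (le2 : (i' <= i'')%O) (le3 : (i <= i'')%O),
    is_map le1 \oc is_map le2 = is_map le3
}.
Arguments is_index {C} X : rename.
Arguments is_map {C} X {i i'} _ : rename.

Record system_hom (C : category) (X Y : inverse_system C) := SystemHom {
  sh_index : semilattice_hom (is_index Y) (is_index X);
  sh_map : forall j : is_index Y, hom (X (sh_index j)) (Y j);
  sh_natural : forall (j j' : is_index Y) (le_jj' : (j <= j')%O),
    sh_map j \oc is_map X (sl_homo sh_index le_jj') =
    is_map Y le_jj' \oc sh_map j'
}.

Section SemInv.
Variable C : category.

(* The index maps being definitionally equal avoids a transport.              *)
Lemma system_hom_eq (X Y : inverse_system C)
    (phi : is_index Y -> is_index X) H1 H2 H1' H2'
    (f g : forall j : is_index Y, hom (X (phi j)) (Y j)) Hf Hg :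
  (forall j, f j = g j) ->
  @SystemHom C X Y (@SemilatticeHom _ _ phi H1 H2) f Hf =
  @SystemHom C X Y (@SemilatticeHom _ _ phi H1' H2') g Hg.
Proof.
move=> fg; have {}fg : f = g by apply: functional_extensionality_dep.
move: Hf Hg; rewrite (Prop_irrelevance H1 H1') (Prop_irrelevance H2 H2') fg.
by move=> Hf Hg; rewrite (Prop_irrelevance Hf Hg).
Qed.

Section Id.
Variable X : inverse_system C.

Lemma system_id_natural (i i' : is_index X) (le_ii' : (i <= i')%O) :
  idm (X i) \oc is_map X (sl_homo (sl_id (is_index X)) le_ii') =
  is_map X le_ii' \oc idm (X i').
Proof.
by rewrite compIm compmI; congr (is_map X _); apply: Prop_irrelevance.
Qed.

Definition system_id : system_hom X X := SystemHom system_id_natural.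

End Id.

Section Comp.
Variables (X Y Z : inverse_system C).
Variables (g : system_hom Y Z) (f : system_hom X Y).

Let phi := sl_comp (sh_index f) (sh_index g).

Let cmp (k : is_index Z) : hom (X (phi k)) (Z k) :=
  sh_map g k \oc sh_map f (sh_index g k).

Lemma system_comp_natural (k k' : is_index Z) (le_kk' : (k <= k')%O) :
  cmp k \oc is_map X (sl_homo phi le_kk') = is_map Z le_kk' \oc cmp k'.
Proof.
rewrite /cmp compA -sh_natural -!compA -sh_natural.
by congr (_ \oc (_ \oc is_map X _)); apply: Prop_irrelevance.
Qed.

Definition system_comp : system_hom X Z := SystemHom system_comp_natural.

End Comp.

Lemma system_compIm (X Y : inverse_system C) (f : system_hom X Y) :
  system_comp (system_id Y) f = f.
Proof.
case: f => -[phi H1 H2] f Hf; apply: system_hom_eq => j /=; exact: compIm.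
Qed.

Lemma system_compmI (X Y : inverse_system C) (f : system_hom X Y) :
  system_comp f (system_id X) = f.
Proof.
case: f => -[phi H1 H2] f Hf; apply: system_hom_eq => j /=; exact: compmI.
Qed.

Lemma system_compA (W X Y Z : inverse_system C) (h : system_hom Y Z)
    (g : system_hom X Y) (f : system_hom W X) :
  system_comp h (system_comp g f) = system_comp (system_comp h g) f.
Proof. by apply: system_hom_eq => j /=; exact: compA. Qed.

Definition Sem_inv : category :=
  @Category (inverse_system C) (@system_hom C)
    system_id system_comp system_compIm system_compmI system_compA.

End SemInv.

Record ibsl := Ibsl {
  ib_sort :> Type;
  ib_mul : ib_sort -> ib_sort -> ib_sort;
  ib_add : ib_sort -> ib_sort -> ib_sort;
  ib_neg : ib_sort -> ib_sort;
  ib_zero : ib_sort;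
  ib_one : ib_sort;
  ib_addxx : forall x, ib_add x x = x;
  ib_addC : forall x y, ib_add x y = ib_add y x;
  ib_addA : forall x y z, ib_add x (ib_add y z) = ib_add (ib_add x y) z;
  ib_negK : forall x, ib_neg (ib_neg x) = x;
  ib_mulE : forall x y, ib_mul x y = ib_neg (ib_add (ib_neg x) (ib_neg y));
  ib_mul_negD : forall x y, ib_mul x (ib_add (ib_neg x) y) = ib_mul x y;
  ib_add0x : forall x, ib_add ib_zero x = x;
  ib_oneE : ib_one = ib_neg ib_zero
}.
Arguments ib_zero {i}.
Arguments ib_one {i}.

Record ibsl_hom (A B : ibsl) := IbslHom {
  ih_fun :> A -> B;
  ih_mul : forall x y, ih_fun (ib_mul x y) = ib_mul (ih_fun x) (ih_fun y);
  ih_add : forall x y, ih_fun (ib_add x y) = ib_add (ih_fun x) (ih_fun y);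
  ih_neg : forall x, ih_fun (ib_neg x) = ib_neg (ih_fun x);
  ih_zero : ih_fun ib_zero = ib_zero;
  ih_one : ih_fun ib_one = ib_one
}.

Section IbslCat.

Lemma ibsl_hom_eq (A B : ibsl) (f g : ibsl_hom A B) : f =1 g -> f = g.
Proof.
case: f g => [f a1 a2 a3 a4 a5] [g b1 b2 b3 b4 b5] /= /funext fg.
by subst g; congr IbslHom; apply: Prop_irrelevance.
Qed.

Definition ibsl_id (A : ibsl) : ibsl_hom A A :=
  @IbslHom A A id (fun _ _ => erefl) (fun _ _ => erefl) (fun _ => erefl)
    erefl erefl.

Definition ibsl_comp (A B D : ibsl) (g : ibsl_hom B D) (f : ibsl_hom A B) :
  ibsl_hom A D.
Proof.
exists (g \o f) => [x y|x y|x||] /=.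
- by rewrite !ih_mul.
- by rewrite !ih_add.
- by rewrite !ih_neg.
- by rewrite !ih_zero.
- by rewrite !ih_one.
Defined.

Lemma ibsl_compIm (A B : ibsl) (f : ibsl_hom A B) : ibsl_comp (ibsl_id B) f = f.
Proof. exact: ibsl_hom_eq. Qed.

Lemma ibsl_compmI (A B : ibsl) (f : ibsl_hom A B) : ibsl_comp f (ibsl_id A) = f.
Proof. exact: ibsl_hom_eq. Qed.

Lemma ibsl_compA (A B D E : ibsl) (h : ibsl_hom D E) (g : ibsl_hom B D)
    (f : ibsl_hom A B) :
  ibsl_comp h (ibsl_comp g f) = ibsl_comp (ibsl_comp h g) f.
Proof. exact: ibsl_hom_eq. Qed.

Definition IBSL : category :=
  @Category ibsl ibsl_hom ibsl_id ibsl_comp ibsl_compIm ibsl_compmI ibsl_compA.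

End IbslCat.

(* Main.v *)
(* The clopen sets of the spaces of an inverse system, tagged with their
   indices, form an involutive bisemilattice: a sum is the union of the preimages
   at the join of the indices, and negation is the complement within a fibre.
   This contravariant functor is fully faithful and essentially surjective.

   Fully faithful: a homomorphism between such algebras determines the index map
   through the empty sets; for a point [x] above an index, the clopen sets whose
   image contains [x] form an ultrafilter, which converges to the image of [x].

   Essentially surjective: in an involutive bisemilattice the elements with the
   same value of [x * x'] form a Boolean algebra with least element [x * x'], and
   these least elements form a semilattice under [+]. The maps [x |-> x + j] are
   the transition homomorphisms, so that Stone duality in each fibre yields an
   inverse system of Stone spaces representing the algebra. *)
From HB Require Import structures.
From mathcomp Require Import all_boot all_order.
From mathcomp Require Import boolp classical_sets filter topology.
Require Import Defs.

Set Implicit Arguments.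
Unset Strict Implicit.
Unset Printing Implicit Defensive.

Import Order.TTheory.
Local Open Scope classical_set_scope.
Local Open Scope cat_scope.

(** * Dual equivalence from a fully faithful, essentially surjective cofunctor *)

Section FullyFaithful.
Variables (C D : category) (F : cofunctor C D).
Hypothesis F_faithful : forall X Y (f g : hom X Y), cmap F f = cmap F g -> f = g.
Hypothesis F_full :
  forall X Y (g : hom (F Y) (F X)), exists f : hom X Y, cmap F f = g.
Hypothesis F_ess_surj : forall B : D, exists (X : C) (u : hom (F X) B)
  (v : hom B (F X)), v \oc u = idm (F X) /\ u \oc v = idm B.

Let preimg X Y (g : hom (F Y) (F X)) : hom X Y := projT1 (cid (F_full g)).

Let preimgK X Y (g : hom (F Y) (F X)) : cmap F (preimg g) = g.
Proof. exact: projT2 (cid (F_full g)). Qed.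

Let gobj B : C := projT1 (cid (F_ess_surj B)).
Let eps B : hom (F (gobj B)) B := projT1 (cid (projT2 (cid (F_ess_surj B)))).
Let eta B : hom B (F (gobj B)) :=
  projT1 (cid (projT2 (cid (projT2 (cid (F_ess_surj B)))))).

Let etaK B : eta B \oc eps B = idm _.
Proof. by have [] := projT2 (cid (projT2 (cid (projT2 (cid (F_ess_surj B)))))). Qed.

Let epsK B : eps B \oc eta B = idm _.
Proof. by have [] := projT2 (cid (projT2 (cid (projT2 (cid (F_ess_surj B)))))). Qed.

Let gmap A B (g : hom A B) : hom (gobj B) (gobj A) :=
  preimg (eta B \oc (g \oc eps A)).

Let gmap_id A : gmap (idm A) = idm (gobj A).
Proof. by apply: F_faithful; rewrite preimgK cmap_id compIm etaK. Qed.

Let gmap_comp A B E (g : hom B E) (f : hom A B) :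
  gmap (g \oc f) = gmap f \oc gmap g.
Proof.
apply: F_faithful; rewrite cmap_comp !preimgK.
by rewrite !compA -[_ \oc eps B \oc eta B]compA epsK compmI.
Qed.

Let G : cofunctor D C := Cofunctor gmap_id gmap_comp.

(** On [D] the chosen isomorphisms [eps] are natural by the definition of [gmap]. On [C] the
    components are the lifts of [eta] and [eps] at [F X], and faithfulness lets every equation be
    checked after applying [F]. *)
Lemma dually_equivalent_fully_faithful : dually_equivalent C D.
Proof.
exists F, G; split; constructor.
- unshelve refine (@NaturalIso _ _ (cofunctor_comp G F) (functor_id C)
    (fun X => preimg (eta (F X))) (fun X => preimg (eps (F X))) _ _ _).
  + move=> X; apply: F_faithful.
    by rewrite cmap_comp !preimgK cmap_id etaK.
  + move=> X; apply: F_faithful.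
    by rewrite cmap_comp !preimgK cmap_id epsK.
  + move=> X Y f; apply: F_faithful; rewrite !cmap_comp !preimgK /=.
    by rewrite -!compA epsK compmI.
- unshelve refine (@NaturalIso _ _ (cofunctor_comp F G) (functor_id D)
    (fun B => eps B) (fun B => eta B) _ _ _).
  + by move=> B; rewrite etaK.
  + by move=> B; rewrite epsK.
  + by move=> A B g /=; rewrite preimgK compA epsK compIm.
Qed.

End FullyFaithful.

Lemma ibsl_bij_iso (A B : ibsl) (f : ibsl_hom A B) :
  injective f -> (forall b, exists a, f a = b) ->
  exists g : ibsl_hom B A,
    ibsl_comp g f = ibsl_id A /\ ibsl_comp f g = ibsl_id B.
Proof.
move=> f_inj f_surj; have [g gK] := choice f_surj.
unshelve eexists.
  exists g => [x y|x y|x||]; apply: f_inj.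
  - by rewrite ih_mul !gK.
  - by rewrite ih_add !gK.
  - by rewrite ih_neg !gK.
  - by rewrite ih_zero !gK.
  - by rewrite ih_one !gK.
split; apply: ibsl_hom_eq => x /=; last by rewrite gK.
by apply: f_inj; rewrite gK.
Qed.

Section IbslHomOfAddNeg.
Variables (A B : ibsl) (f : A -> B).
Hypothesis f_add : forall x y, f (ib_add x y) = ib_add (f x) (f y).
Hypothesis f_neg : forall x, f (ib_neg x) = ib_neg (f x).
Hypothesis f_zero : f ib_zero = ib_zero.

Lemma ibsl_hom_of_add_neg_mul x y : f (ib_mul x y) = ib_mul (f x) (f y).
Proof. by rewrite !ib_mulE f_neg f_add !f_neg. Qed.

Lemma ibsl_hom_of_add_neg_one : f ib_one = ib_one.
Proof. by rewrite !ib_oneE f_neg f_zero. Qed.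

Definition ibsl_hom_of_add_neg : ibsl_hom A B :=
  IbslHom ibsl_hom_of_add_neg_mul f_add f_neg f_zero ibsl_hom_of_add_neg_one.

End IbslHomOfAddNeg.

(** * Stone spaces *)

(** The members of [D] form a base of a proper filter. A cluster point of it lies in the closure of
    each member, and the members are closed. *)
Lemma compact_directed_bigcap (X : topologicalType) (D : set (set X)) :
  compact [set: X] -> D !=set0 ->
  (forall A, D A -> closed A /\ A !=set0) ->
  (forall A B, D A -> D B -> exists2 E, D E & E `<=` A `&` B) ->
  exists x, forall A, D A -> A x.
Proof.
move=> cX [A0 DA0] Dcl Ddir.
have FF : ProperFilter (filter_from D id).
  apply: filter_from_proper; last by move=> A /Dcl[].
  by apply: filter_from_filter => //; exists A0.
have [x [_]] := cX _ FF (@filterT _ _ _).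
rewrite clusterE => clx; exists x => A DA.
by apply: (proj1 (Dcl _ DA)); apply: clx; exists A.
Qed.

(* In a compact Hausdorff space the intersection of the clopen sets through a
   point is connected. *)
Lemma stone_zero_dimensional (X : stoneSpace) : zero_dimensional X.
Proof.
move=> x y xy; apply: contrapT => nsep.
pose Q : set X := [set z | forall D, clopen D -> D x -> D z].
have clQ : closed Q.
  rewrite (_ : Q = \bigcap_(D in [set D | clopen D /\ D x]) D).
    by apply: closed_bigI => D [[]].
  apply/seteqP; split=> z /= Qz; first by move=> D [cD Dx]; exact: Qz.
  by move=> D cD Dx; apply: Qz.
have Qx : Q x by [].
have Qy : Q y.
  by move=> D cD Dx; apply: contrapT => nDy; apply: nsep; exists D.
(* A connected [Q] puts [y] in the connected component of [x], which is a singleton. *)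
suff Qconn : connected Q.
  have : connected_component setT x y.
    by apply: (connected_component_max (B := Q)).
  by rewrite (@stone_disconnected X x) // => yx; rewrite yx eqxx in xy.
move=> B B0 [C oC BC] [E cE BE].
have clB : closed B by rewrite BE; apply: closedI.
have clP : closed (Q `\` B).
  rewrite (_ : Q `\` B = Q `&` ~` C); last first.
    rewrite BC; apply/seteqP; split=> z /= [Qz nz]; split=> //.
      by move=> Cz; apply: nz.
    by move=> [].
  by apply: closedI => //; exact: open_closedC.
(* Normality separates the disjoint closed sets [B] and [Q \ B] by disjoint open sets [U] and
   [V]. *)
have nX := compact_normal (@stone_hausdorff X) (@stone_compact X).
have [N BN NP] : filter_from (set_nbhs B) closure (~` (Q `\` B)).
  apply: nX => //.
  apply/set_nbhsP; exists (~` (Q `\` B)); split=> //; first exact: closed_openC.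
  by move=> z Bz [].
have /set_nbhsP[U [oU BU UN]] := BN.
pose V := ~` closure N.
have oV : open V by apply: closed_openC; exact: closed_closure.
have UV z : U z -> ~ V z by move=> /UN Nz; apply; exact: subset_closure.
have QUV : Q `<=` U `|` V.
  move=> z Qz; have [Bz|nBz] := pselect (B z); first by left; exact: BU.
  by right; rewrite /V /setC /= => /NP; apply.
(* Otherwise the differences of clopen sets through [x] with the union of [U] and [V] are nonempty,
   closed and directed. By compactness they share a point, which lies in [Q] but in neither [U] nor
   [V]. *)
have [D [cD Dx DUV]] : exists D, [/\ clopen D, D x & D `<=` U `|` V].
  apply: contrapT => nD.
  have [] := @compact_directed_bigcap X
    [set K | exists D, [/\ clopen D, D x & K = D `\` (U `|` V)]].
  - exact: stone_compact.
  - by exists (setT `\` (U `|` V)), setT; split=> //; exact: clopenT.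
  - move=> _ [D [cD Dx ->]]; split.
      apply: closedI; first by case: cD.
      by apply: open_closedC; apply: openU.
    apply: contrapT => /set0P/negP; rewrite negbK => /eqP D0; apply: nD.
    exists D; split=> // z Dz; apply: contrapT => nz.
    by have : (D `\` (U `|` V)) z by []; rewrite D0.
  - move=> _ _ [D [cD Dx ->]] [D' [cD' D'x ->]].
    exists ((D `&` D') `\` (U `|` V)).
      by exists (D `&` D'); split=> //; apply: clopenI.
    by move=> z [[]].
  - move=> z Kz.
    have [//|Qz] := pselect (Q z).
      move=> /QUV UVz.
      have [] : (setT `\` (U `|` V)) z.
        by apply: Kz; exists setT; split=> //; exact: clopenT.
      by [].
    apply: Qz => D cD Dx.
    by have [] : (D `\` (U `|` V)) z by apply: Kz; exists D.
(* Inside [D] the sets [U] and [V] are complementary, so both traces are clopen. *)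
have cDU : clopen (D `&` U).
  split; first by apply: openI => //; case: cD.
  rewrite (_ : D `&` U = D `&` ~` V).
    by apply: closedI; [case: cD|exact: open_closedC].
  apply/seteqP; split=> z /= [Dz Uz]; split=> //; first exact: UV.
  by have [] := DUV z Dz.
have cDV : clopen (D `&` V).
  split; first by apply: openI => //; case: cD.
  rewrite (_ : D `&` V = D `&` ~` U).
    by apply: closedI; [case: cD|exact: open_closedC].
  apply/seteqP; split=> z /= [Dz Vz]; split=> //; first by move=> /UV.
  by have [] := DUV z Dz.
have BQ : B `<=` Q by rewrite BC => z [].
apply/seteqP; split=> // z Qz.
(* [Q] is contained in the trace through [x]. If this is the one on [U], then [Q] avoids [Q \ B]; if
   it is the one on [V], a point of [B] would lie in both [U] and [V]. *)
have [Ux|Vx] := QUV _ Qx.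
  apply: contrapT => nBz.
  have [_ /UN/subset_closure/NP] := Qz _ cDU (conj Dx Ux); exact.
have [b Bb] := B0.
by have [_ /(UV _ (BU _ Bb))] := BQ _ Bb _ cDV (conj Dx Vx).
Qed.

Lemma stone_clopen_nbhs (X : stoneSpace) (x : X) (U : set X) :
  nbhs x U -> exists V, [/\ clopen V, V x & V `<=` U].
Proof.
move=> xU; have := zero_dimensional_cvg (x := x) (@stone_hausdorff X)
  (@stone_zero_dimensional X) (@stone_compact X).
by move=> /(_ U xU)[V [Vx cV] VU]; exists V.
Qed.

Lemma stone_clopen_inj (X : stoneSpace) (x y : X) :
  (forall V, clopen V -> V x -> V y) -> x = y.
Proof.
move=> xy; apply/eqP; apply: contrapT => /negP /stone_zero_dimensional.
by move=> [V [cV Vx nVy]]; exact/nVy/(xy V).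
Qed.

(** The clopen sets satisfying [h] form an ultrafilter of the clopen algebra. Compactness gives a
    point common to them all, and complements give the converse implication. *)
Lemma stone_point (X : stoneSpace) (h : set X -> Prop) :
  (forall U V, clopen U -> clopen V -> h (U `|` V) <-> h U \/ h V) ->
  (forall U, clopen U -> h (~` U) <-> ~ h U) ->
  exists x, forall U, clopen U -> h U <-> U x.
Proof.
move=> hU hC.
have cC (U : set X) : clopen U -> clopen (~` U) by exact: (clopenC set0).
have hI U V : clopen U -> clopen V -> h U -> h V -> h (U `&` V).
  move=> cU cV hUU hVV; rewrite -[_ `&` _]setCK setCI.
  apply/hC; first by apply: clopenU; apply: cC.
  by move=> /(proj1 (hU _ _ (cC _ cU) (cC _ cV)))[/hC|/hC]; exact.
have [h0 hT] : ~ h set0 /\ h setT.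
  have := hU set0 setT clopen0 clopenT; rewrite set0U.
  by have := hC _ clopen0; rewrite setC0; tauto.
have [||||x hx] := @compact_directed_bigcap X [set V | clopen V /\ h V].
- exact: stone_compact.
- by exists setT; split=> //; exact: clopenT.
- move=> A [cA hA]; split; first by case: cA.
  by apply/set0P/eqP => A0; rewrite A0 in hA.
- move=> A B [cA hA] [cB hB]; exists (A `&` B) => //.
  by split; [exact: clopenI|exact: hI].
exists x => U cU; split=> [hUU|Ux]; first exact: hx.
by apply: contrapT => /hC-/(_ cU) hCU; have := hx _ (conj (cC _ cU) hCU).
Qed.

(** * The algebra of clopen sets of an inverse system *)

Definition space (X : SA) : topologicalType := stone_sort X.

Definition app (X Y : SA) (f : hom X Y) : space X -> space Y :=
  (f : continuousType X Y).

Lemma app_continuous (X Y : SA) (f : hom X Y) : continuous (app f).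
Proof. exact: cts_fun. Qed.

Lemma app_ext (X Y : SA) (f g : hom X Y) : app f =1 app g -> f = g.
Proof. by move=> fg; apply/continuousEP. Qed.

Section ClopenAlgebra.
Variable X : inverse_system SA.
Local Notation I := (is_index X).

Definition pt (i : I) : topologicalType := space (X i).

Definition tr (i j : I) (le_ij : (i <= j)%O) : pt j -> pt i :=
  app (is_map X le_ij).

Lemma tr_continuous i j (le_ij : (i <= j)%O) : continuous (tr le_ij).
Proof. exact: app_continuous. Qed.

Lemma tr_id i (le_ii : (i <= i)%O) x : tr le_ii x = x.
Proof. by rewrite /tr is_map_id. Qed.

Lemma tr_comp i j k (le_ij : (i <= j)%O) (le_jk : (j <= k)%O)
    (le_ik : (i <= k)%O) x :
  tr le_ij (tr le_jk x) = tr le_ik x.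
Proof. by rewrite /tr -(is_map_comp le_ij le_jk). Qed.

Record clopen_elt := ClopenElt {
  ce_index : I;
  ce_set : set (pt ce_index);
  ce_clopen : clopen ce_set
}.

(* The preimage of a clopen set at a higher index: it allows elements of
   propositionally equal indices to be compared without transport. *)
Definition res (a : clopen_elt) (k : I) : set (pt k) :=
  [set x | exists le : (ce_index a <= k)%O, ce_set (tr le x)].

Lemma resE a k (le : (ce_index a <= k)%O) x : res a x <-> ce_set (tr le x).
Proof.
split=> [[le']|]; last by exists le.
by rewrite (Prop_irrelevance le' le).
Qed.

Lemma res_id a (x : pt (ce_index a)) : res a x <-> ce_set x.
Proof. by rewrite (resE (lexx _)) tr_id. Qed.

Lemma res_tr a k l (le_ak : (ce_index a <= k)%O) (le_kl : (k <= l)%O) x :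
  res a (tr le_kl x) <-> res a x.
Proof.
have le_al := le_trans le_ak le_kl.
by rewrite (resE le_ak) (resE le_al) (tr_comp _ _ le_al).
Qed.

Lemma clopen_res a k : (ce_index a <= k)%O -> clopen (@res a k).
Proof.
move=> le; rewrite (_ : @res a k = tr le @^-1` ce_set (c := a)).
  by apply: preimage_clopen; [exact: ce_clopen|exact: tr_continuous].
by apply/seteqP; split=> x; [move=> /(resE le)|move=> ?; apply/(resE le)].
Qed.

(** Reduces each identity of the algebra to an equation in the index semilattice and a propositional
    tautology about points. *)
Lemma clopen_elt_ext a b : ce_index a = ce_index b ->
  (forall x : pt (ce_index a), res a x <-> res b x) -> a = b.
Proof.
case: a b => [i U cU] [j V cV] /= ij; case: _ / ij in V cV * => UV.
have {}UV : U = V.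
  apply/seteqP; split=> x Ux.
    by apply/(res_id (a := ClopenElt cV))/UV/(res_id (a := ClopenElt cU)).
  by apply/(res_id (a := ClopenElt cU))/UV/(res_id (a := ClopenElt cV)).
by case: _ / UV in cV *; rewrite (Prop_irrelevance cU cV).
Qed.

Lemma clopen_add a b :
  clopen (@res a (ce_index a `|` ce_index b)%O `|` @res b _).
Proof. by apply: clopenU; apply: clopen_res; [exact: leUl|exact: leUr]. Qed.

Definition ce_add a b := ClopenElt (clopen_add a b).

Definition ce_neg a := ClopenElt (clopenC set0 (ce_clopen a)).

Definition ce_mul a b := ce_neg (ce_add (ce_neg a) (ce_neg b)).

Definition ce_bot (i : I) := ClopenElt (@clopen0 (pt i)).

Lemma res_add a b k (x : pt k) : (ce_index a `|` ce_index b <= k)%O ->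
  res (ce_add a b) x <-> res a x \/ res b x.
Proof.
move=> le; rewrite (resE (le : (ce_index (ce_add a b) <= k)%O)) /=.
by rewrite /setU /= res_tr ?leUl // res_tr ?leUr.
Qed.

Lemma res_neg a k (x : pt k) : (ce_index a <= k)%O ->
  res (ce_neg a) x <-> ~ res a x.
Proof.
move=> le; rewrite (resE le) (resE (le : (ce_index (ce_neg a) <= k)%O)).
by [].
Qed.

Lemma res_mul a b k (x : pt k) : (ce_index a `|` ce_index b <= k)%O ->
  res (ce_mul a b) x <-> res a x /\ res b x.
Proof.
move=> le; have := le; rewrite leUx => /andP[lea leb].
rewrite res_neg // res_add // !res_neg //; split=> [h|]; last by tauto.
by split; apply: contrapT; tauto.
Qed.

Lemma res_bot i k (x : pt k) : ~ res (ce_bot i) x.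
Proof. by case. Qed.

Lemma ce_addxx a : ce_add a a = a.
Proof.
apply: clopen_elt_ext => /=; first exact: joinxx.
by move=> x; rewrite res_add; [tauto|exact: lexx].
Qed.

Lemma ce_addC a b : ce_add a b = ce_add b a.
Proof.
apply: clopen_elt_ext => /=; first exact: joinC.
by move=> x; rewrite !res_add 1?joinC //; tauto.
Qed.

Lemma ce_addA a b c : ce_add a (ce_add b c) = ce_add (ce_add a b) c.
Proof.
apply: clopen_elt_ext => /=; first exact: joinA.
move=> x; rewrite !res_add /= ?joinA ?leUl //; first by tauto.
by rewrite -joinA leUr.
Qed.

Lemma ce_negK a : ce_neg (ce_neg a) = a.
Proof.
apply: clopen_elt_ext => //= x.
by rewrite !res_neg /= ?lexx //; split=> [/contrapT|]; tauto.
Qed.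

Lemma ce_mul_negD a b : ce_mul a (ce_add (ce_neg a) b) = ce_mul a b.
Proof.
apply: clopen_elt_ext => /=; first by rewrite joinA joinxx.
move=> x; have leb : (ce_index b <= ce_index a `|` (ce_index a `|` ce_index b))%O.
  by rewrite joinA leUr.
rewrite !res_mul ?res_add ?res_neg //= ?joinA ?joinxx ?leUl //.
by tauto.
Qed.

Lemma ce_add0x a : ce_add (ce_bot \bot%O) a = a.
Proof.
apply: clopen_elt_ext => /=; first exact: join0x.
by move=> x; rewrite res_add //; have := @res_bot \bot%O _ x; tauto.
Qed.

Definition clopen_algebra : ibsl :=
  @Ibsl clopen_elt ce_mul ce_add ce_neg (ce_bot \bot%O) (ce_neg (ce_bot \bot%O))
    ce_addxx ce_addC ce_addA ce_negK (fun _ _ => erefl) ce_mul_negD ce_add0x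
    erefl.

(** Exhibits the empty set over an index as a term, hence preserved by homomorphisms. Together with
    [ce_bot_add] it recovers the index semilattice from the algebra. *)
Lemma ce_mulN a : ce_mul a (ce_neg a) = ce_bot (ce_index a).
Proof.
apply: clopen_elt_ext => /=; first exact: joinxx.
move=> x; rewrite res_mul /= ?lexx // res_neg /= ?leUl //.
by have := @res_bot (ce_index a) _ x; tauto.
Qed.

Lemma ce_bot_add i j : ce_add (ce_bot i) (ce_bot j) = ce_bot (i `|` j)%O.
Proof.
apply: clopen_elt_ext => //= x; rewrite res_add //.
have := @res_bot i _ x; have := @res_bot j _ x.
by have := @res_bot (i `|` j)%O _ x; tauto.
Qed.

End ClopenAlgebra.

Arguments pt : clear implicits.
Arguments ce_bot : clear implicits.

(** * The contravariant clopen functor and its faithfulness *)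

Section ClopenMap.
Variables (X Y : inverse_system SA) (f : system_hom X Y).

Definition comp_at (j : is_index Y) : pt X (sh_index f j) -> pt Y j :=
  app (sh_map f j).

Lemma comp_at_continuous j : continuous (@comp_at j).
Proof. exact: app_continuous. Qed.

Lemma comp_at_tr j j' (le_jj' : (j <= j')%O) x :
  comp_at (tr (sl_homo (sh_index f) le_jj') x) = tr le_jj' (comp_at x).
Proof.
have := sh_natural f le_jj' => /(congr1 (fun h => app h x)).
by [].
Qed.

Definition ce_map (a : clopen_elt Y) : clopen_elt X :=
  ClopenElt (preimage_clopen (ce_clopen a) (@comp_at_continuous (ce_index a))).

Lemma res_map a j (x : pt X (sh_index f j)) : (ce_index a <= j)%O ->
  res (ce_map a) x <-> res a (comp_at x).
Proof.
move=> le; rewrite (resE (a := ce_map a) (sl_homo (sh_index f) le)) (resE le).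
by rewrite -comp_at_tr.
Qed.

Lemma ce_map_add a b : ce_map (ce_add a b) = ce_add (ce_map a) (ce_map b).
Proof.
apply: clopen_elt_ext => /=; first exact: sl_join.
move=> x; rewrite res_map //= !res_add //= ?sl_join //.
by rewrite !res_map ?leUl ?leUr.
Qed.

Lemma ce_map_neg a : ce_map (ce_neg a) = ce_neg (ce_map a).
Proof.
by apply: clopen_elt_ext => //= x; rewrite res_map //= !res_neg //= res_map.
Qed.

Lemma ce_map_zero : ce_map (ce_bot Y \bot%O) = ce_bot X \bot%O.
Proof.
apply: clopen_elt_ext => /=; first exact: sl_bot.
by move=> x; rewrite res_map //=; split=> /res_bot.
Qed.

Definition clopen_map :
    ibsl_hom (clopen_algebra Y) (clopen_algebra X) :=
  @ibsl_hom_of_add_neg (clopen_algebra Y) (clopen_algebra X) ce_map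
    ce_map_add ce_map_neg ce_map_zero.

End ClopenMap.

Lemma clopen_map_id (X : Sem_inv SA) :
  clopen_map (idm X) = ibsl_id (clopen_algebra X).
Proof.
by apply: ibsl_hom_eq => a; apply: clopen_elt_ext => //= x; rewrite !res_id.
Qed.

Lemma clopen_map_comp (X Y Z : Sem_inv SA) (g : hom Y Z) (f : hom X Y) :
  clopen_map (g \oc f) = ibsl_comp (clopen_map f) (clopen_map g).
Proof.
by apply: ibsl_hom_eq => a; apply: clopen_elt_ext => //= x; rewrite !res_id.
Qed.

Definition clopen_functor : cofunctor (Sem_inv SA) IBSL :=
  @Cofunctor (Sem_inv SA) IBSL clopen_algebra clopen_map
    clopen_map_id clopen_map_comp.

Lemma pt_clopen_inj (X : inverse_system SA) i (x y : pt X i) :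
  (forall V, clopen V -> V x -> V y) -> x = y.
Proof. exact: (@stone_clopen_inj (X i)). Qed.

(** The images of the empty sets give the index map; the preimages of clopen sets give the component
    maps, because clopen sets separate points. *)
Lemma clopen_functor_faithful (X Y : Sem_inv SA) (f g : hom X Y) :
  cmap clopen_functor f = cmap clopen_functor g -> f = g.
Proof.
move=> fg.
have {}fg a : ce_map f a = ce_map g a by have := 
  congr1 (fun h : ibsl_hom (clopen_algebra Y) (clopen_algebra X) => h a) fg.
case: f g fg => -[phi H1 H2] f Hf [[psi K1 K2] g Kg] fg.
have : phi = psi.
  by apply: funext => j; have := congr1 (@ce_index X) (fg (ce_bot Y j)).
(* Eliminating the equality gives both families of components the same domains, as [system_hom_eq]
   requires. *)
move=> E; case: _ / E in K1 K2 g Kg fg *.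
apply: system_hom_eq => j; apply: app_ext => x; apply: pt_clopen_inj => V cV Vx.
have : res (ce_map (SystemHom Hf) (ClopenElt cV)) x.
  by apply/(res_id (a := ce_map _ _)).
by rewrite fg => /(res_id (a := ce_map _ _)).
Qed.

(** * Fullness of the clopen functor *)

Section Full.
Variables (X Y : inverse_system SA).
Variable g : ibsl_hom (clopen_algebra Y) (clopen_algebra X).

Let phi (j : is_index Y) : is_index X := ce_index (g (ce_bot Y j)).

Let g_add a b : g (ce_add a b) = ce_add (g a) (g b).
Proof. exact: ih_add. Qed.

Let g_neg a : g (ce_neg a) = ce_neg (g a).
Proof. exact: ih_neg. Qed.

(** Both empty sets are the product of an element with its negation. Hence the index of [g a]
    depends only on the index of [a]. *)
Let g_bot (a : clopen_elt Y) :
  g (ce_bot Y (ce_index a)) = ce_bot X (ce_index (g a)).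
Proof. by rewrite -!ce_mulN /ce_mul g_neg g_add !g_neg. Qed.

Let index_g a : ce_index (g a) = phi (ce_index a).
Proof. by rewrite /phi g_bot. Qed.

Let phi_join j j' : phi (j `|` j')%O = (phi j `|` phi j')%O.
Proof. by rewrite /phi -ce_bot_add g_add. Qed.

Let phi_bot : phi \bot%O = \bot%O.
Proof. by rewrite /phi; have /= -> := ih_zero g. Qed.

Let phi_hom : semilattice_hom (is_index Y) (is_index X) :=
  SemilatticeHom phi_join phi_bot.

Let point_exists j (x : pt X (phi j)) :
  exists y : pt Y j, forall V (cV : clopen V),
    res (g (ClopenElt cV)) x <-> V y.
Proof.
(* [stone_point] expects a predicate on all sets, so the clopenness proof is quantified; proof
   irrelevance makes its choice harmless. *)
have [||y hy] := @stone_point (Y j)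
    (fun V => exists cV : clopen (V : set (pt Y j)), res (g (ClopenElt cV)) x).
- move=> U V cU cV.
  have -> : (exists c, res (g (@ClopenElt Y j (U `|` V) c)) x) <->
      res (ce_add (g (@ClopenElt Y j U cU)) (g (@ClopenElt Y j V cV))) x.
    rewrite -g_add.
    have c := clopenU cU cV.
    rewrite (_ : ce_add _ _ = @ClopenElt Y j (U `|` V) c).
      split=> [[c']|]; last by exists c.
      by rewrite (Prop_irrelevance c c').
    apply: clopen_elt_ext => /= [|z]; first exact: joinxx.
    rewrite res_add //=.
    by rewrite !(resE (a := @ClopenElt Y j _ _) (leUl j j)) /=.
  rewrite res_add ?index_g ?joinxx //=.
  split=> [[?|?]|[[c ?]|[c ?]]].
  + by left; exists cU.
  + by right; exists cV.
  + by left; rewrite (Prop_irrelevance cU c).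
  + by right; rewrite (Prop_irrelevance cV c).
- move=> U cU; have c := clopenC set0 cU.
  have -> : (exists c, res (g (@ClopenElt Y j (~` U) c)) x) <->
      res (ce_neg (g (@ClopenElt Y j U cU))) x.
    rewrite -g_neg (_ : ce_neg _ = @ClopenElt Y j (~` U) c).
      split=> [[c']|]; last by exists c.
      by rewrite (Prop_irrelevance c c').
    by apply: clopen_elt_ext.
  rewrite res_neg ?index_g //; split=> [nh [c']|nh h].
    by rewrite (Prop_irrelevance c' cU).
  by apply: nh; exists cU.
exists y => V cV; rewrite -(hy V cV); split=> [|[c]]; first by exists cV.
by rewrite (Prop_irrelevance c cV).
Qed.

Let fpt j (x : pt X (phi j)) : pt Y j := projT1 (cid (point_exists x)).

Let fptP j (x : pt X (phi j)) V (cV : clopen V) :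
  V (fpt x) <-> res (g (ClopenElt cV)) x.
Proof. by have := projT2 (cid (point_exists x)) V cV => ->. Qed.

(** By [fptP] the preimage of a clopen [V] is the clopen set that [g] assigns to it, and clopen
    neighbourhoods suffice in a Stone space. *)
Let fpt_continuous j : continuous (@fpt j).
Proof.
move=> x U /(@stone_clopen_nbhs (Y j)) [V [cV Vx VU]].
have [oR _] : clopen (@res X (g (@ClopenElt Y j V cV)) (phi j)).
  by apply: clopen_res; rewrite index_g.
apply: (filterS (P := @res X (g (@ClopenElt Y j V cV)) (phi j))).
  by move=> z hz; apply: VU; apply/(fptP _ cV).
by apply: open_nbhs_nbhs; split=> //; apply/fptP.
Qed.

Let fhom j : hom (X (phi_hom j)) (Y j) := mkcts (@fpt_continuous j).

Let fhom_natural j j' (le_jj' : (j <= j')%O) :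
  fhom j \oc is_map X (sl_homo phi_hom le_jj') = is_map Y le_jj' \oc fhom j'.
Proof.
apply: app_ext => x; apply: pt_clopen_inj => V cV.
rewrite -[app _ x]/(fpt (tr (sl_homo phi_hom le_jj') x)).
rewrite -[app (_ \oc _) x]/(tr le_jj' (fpt (x : pt X (phi j')))).
move=> /(fptP _ cV) h.
have cV' := preimage_clopen cV (@tr_continuous Y _ _ le_jj').
apply/(fptP _ cV').
(* Pulling [V] back to the index [j'] amounts to adding the empty set over [j'], an operation that
   [g] preserves. *)
have -> : ClopenElt cV' = ce_add (ClopenElt cV) (ce_bot Y j').
  apply: clopen_elt_ext => /= [|z]; first by rewrite join_r.
  rewrite res_add /=; last by rewrite join_r.
  rewrite res_id (resE (a := ClopenElt cV) le_jj').
  by split=> [|[//|/res_bot]]; first by left.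
rewrite g_add res_add ?index_g /=; last by rewrite -phi_join join_r.
left; move: h; apply: (iffLR (res_tr _ _ _)); rewrite index_g; exact: lexx.
Qed.

Lemma clopen_functor_full_aux : exists f : system_hom X Y, clopen_map f = g.
Proof.
exists (SystemHom fhom_natural); apply: ibsl_hom_eq => -[j V cV].
apply: clopen_elt_ext => /= [|x]; first by rewrite index_g.
rewrite res_id; exact: fptP.
Qed.

End Full.

Lemma clopen_functor_full (X Y : Sem_inv SA)
    (g : hom (clopen_functor Y) (clopen_functor X)) :
  exists f : hom X Y, cmap clopen_functor f = g.
Proof. exact: clopen_functor_full_aux. Qed.

(** * The fibres of an involutive bisemilattice *)

Declare Scope ibsl_scope.
Delimit Scope ibsl_scope with B.
Bind Scope ibsl_scope with ib_sort.
Local Notation "x + y" := (ib_add x y) : ibsl_scope.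
Local Notation "x * y" := (ib_mul x y) : ibsl_scope.
Local Notation "- x" := (ib_neg x) : ibsl_scope.
Local Open Scope ibsl_scope.

Section IbslTheory.
Variable B : ibsl.
Implicit Types x y z i j : B.

Lemma ib_negD x y : - (x + y) = - x * - y.
Proof. by rewrite ib_mulE !ib_negK. Qed.

Lemma ib_negM x y : - (x * y) = - x + - y.
Proof. by rewrite ib_mulE ib_negK. Qed.

Lemma ib_mulC x y : x * y = y * x.
Proof. by rewrite !ib_mulE ib_addC. Qed.

Lemma ib_mulA x y z : x * (y * z) = x * y * z.
Proof. by rewrite !ib_mulE !ib_negK ib_addA. Qed.

Lemma ib_mulxx x : x * x = x.
Proof. by rewrite ib_mulE ib_addxx ib_negK. Qed.

Lemma ib_add_negM x y : x + - x * y = x + y.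
Proof.
by rewrite -[LHS]ib_negK ib_negD [- (- x * y)]ib_negM ib_mul_negD -ib_negD ib_negK.
Qed.

(* The fibre of [x] is the Boolean algebra of the [y] with [bot_of y = bot_of x];
   [bot_of x] is its least element and serves as its index. *)
Definition bot_of x := x * - x.

Lemma bot_of_neg x : bot_of (- x) = bot_of x.
Proof. by rewrite /bot_of ib_negK ib_mulC. Qed.

Lemma add_bot_of x : x + bot_of x = x.
Proof. by rewrite /bot_of ib_mulC ib_add_negM ib_addxx. Qed.

Lemma mul_neg_bot_of x : x * - bot_of x = x.
Proof. by rewrite /bot_of ib_negM ib_negK ib_mul_negD ib_mulxx. Qed.

Lemma mul_bot_of x : x * bot_of x = bot_of x.
Proof. by rewrite /bot_of ib_mulA ib_mulxx. Qed.

Lemma bot_ofK x : bot_of (bot_of x) = bot_of x.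
Proof.
rewrite {1}/bot_of {1}/bot_of [x * - x]ib_mulC -ib_mulA mul_neg_bot_of.
exact: ib_mulC.
Qed.

Lemma bot_of_addl x y : bot_of (x + y) = - x * bot_of y.
Proof.
rewrite /bot_of ib_negD ib_mulC -ib_mulA [- y * _]ib_mulC ib_mulA.
by rewrite -{2}[x]ib_negK ib_mul_negD -ib_mulA.
Qed.

(** By [bot_of_addl] with the summands exchanged, the left-hand side is a multiple of [bot_of x], so
    multiplying by [x] does not change it; [bot_of_addl] itself then gives the product. *)
Lemma bot_of_add_mul x y : bot_of (x + y) = bot_of x * bot_of y.
Proof.
have -> : bot_of (x + y) = x * bot_of (x + y).
  by rewrite ib_addC bot_of_addl ib_mulA [x * _]ib_mulC -ib_mulA mul_bot_of.
by rewrite bot_of_addl ib_mulA.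
Qed.

(** Both sides compute [bot_of (i + j)]. This leads to [bot_add]: sum and product agree on bottom
    elements, so both operations of the algebra induce the same join of indices. *)
Lemma neg_bot_mul i j : bot_of i = i -> bot_of j = j -> - i * j = i * j.
Proof.
move=> bi bj; rewrite -{1}bj -bot_of_addl bot_of_add_mul.
by rewrite bi bj.
Qed.

Lemma bot_add i j : bot_of i = i -> bot_of j = j -> i + j = i * j.
Proof.
move=> bi bj; rewrite -ib_add_negM neg_bot_mul // ib_addC -ib_add_negM.
rewrite ib_negM [_ * i]ib_mulC ib_mul_negD [i * - j]ib_mulC neg_bot_mul //.
by rewrite [j * i]ib_mulC ib_addxx.
Qed.

Lemma bot_of_add x y : bot_of (x + y) = bot_of x + bot_of y.
Proof. by rewrite bot_of_add_mul bot_add ?bot_ofK. Qed.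

Lemma bot_of_mul x y : bot_of (x * y) = bot_of x + bot_of y.
Proof. by rewrite -bot_of_neg ib_negM bot_of_add !bot_of_neg. Qed.

Lemma bot_of_zero : bot_of (ib_zero : B) = ib_zero.
Proof. by rewrite -[bot_of _]ib_add0x add_bot_of. Qed.

(** Moving into a higher fibre by adding its bottom is the same as multiplying by its top; by De
    Morgan this move commutes with negation. *)
Lemma mul_neg_bot x j : bot_of j = j -> x * - j = x + j.
Proof.
move=> bj; have <- : (x + j) * - j = x * - j.
  rewrite ib_mulC [x + j]ib_addC -{2}[j]ib_negK ib_mul_negD.
  exact: ib_mulC.
rewrite -{1}[x + j]mul_neg_bot_of bot_of_add bj ib_negD.
by rewrite -!ib_mulA ib_mulxx -ib_negD -[in - (_ + _)]bj -bot_of_add mul_neg_bot_of.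
Qed.

(** Absorption is a law of a single fibre: in general the left-hand side lies over
    [bot_of x + bot_of y]. *)
Lemma fibre_add_mul x y : bot_of x = bot_of y -> x + x * y = x.
Proof.
move=> bxy; rewrite -ib_add_negM ib_mulA [- x * x]ib_mulC -/(bot_of x) bxy.
by rewrite ib_mulC mul_bot_of -bxy add_bot_of.
Qed.

Lemma fibre_mul_add x y : bot_of x = bot_of y -> x * (x + y) = x.
Proof.
move=> bxy; rewrite ib_mulE [- (x + y)]ib_negD fibre_add_mul ?ib_negK //.
by rewrite !bot_of_neg.
Qed.

Lemma fibre_disjoint x y : x * y = bot_of x -> x * - y = x.
Proof. by move=> xy; rewrite -ib_mul_negD -ib_negM xy mul_neg_bot_of. Qed.

End IbslTheory.

(** * The semilattice of bottom elements *)

Record fibre_index (B : ibsl) := FibreIndex {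
  fi_bot :> B;
  fi_botE : bot_of fi_bot = fi_bot
}.

HB.instance Definition _ (B : ibsl) := gen_eqMixin (fibre_index B).
HB.instance Definition _ (B : ibsl) := gen_choiceMixin (fibre_index B).

Section FibreIndex.
Variable B : ibsl.
Implicit Types i j k : fibre_index B.

Lemma fibre_index_inj i j : i = j :> B -> i = j.
Proof.
case: i j => [i bi] [j bj] /= ij; case: _ / ij in bj *.
by rewrite (Prop_irrelevance bi bj).
Qed.

Definition fi_le i j : bool := `[< i + j = j >].

Lemma fi_join_subproof i j : bot_of (i + j) = i + j.
Proof. by rewrite bot_of_add !fi_botE. Qed.

Definition fi_join i j := FibreIndex (fi_join_subproof i j).

Definition fi_zero := FibreIndex (bot_of_zero B).

Lemma fi_le_refl : reflexive fi_le.
Proof. by move=> i; apply/asboolP; exact: ib_addxx. Qed.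

Lemma fi_le_anti : antisymmetric fi_le.
Proof.
move=> i j /andP[/asboolP ij /asboolP ji]; apply: fibre_index_inj.
by rewrite -ij -{1}ji ib_addC.
Qed.

Lemma fi_le_trans : transitive fi_le.
Proof.
move=> j i k /asboolP ij /asboolP jk; apply/asboolP.
by rewrite -jk ib_addA ij.
Qed.

Lemma fi_leUx i j k : fi_le (fi_join i j) k = fi_le i k && fi_le j k.
Proof.
apply/asboolP/andP => /= [ijk|[/asboolP ik /asboolP jk]].
  split; apply/asboolP; rewrite -ijk !ib_addA ?ib_addxx //.
  by rewrite [j + i]ib_addC -[i + j + j]ib_addA ib_addxx.
by rewrite -ib_addA jk.
Qed.

Lemma fi_le0x i : fi_le fi_zero i.
Proof. by apply/asboolP; exact: ib_add0x. Qed.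

HB.instance Definition _ := Order.Le_isPOrder.Build (Order.Disp tt tt)
  (fibre_index B) fi_le_refl fi_le_anti fi_le_trans.
HB.instance Definition _ := Order.POrder_isJoinSemilattice.Build
  (Order.Disp tt tt) (fibre_index B) fi_leUx.
HB.instance Definition _ := Order.hasBottom.Build (Order.Disp tt tt)
  (fibre_index B) fi_le0x.

Lemma fi_leP i j : (i <= j)%O -> i + j = j.
Proof. by move=> /asboolP. Qed.

End FibreIndex.

(** * Ultrafilters of a fibre *)

Record character (B : ibsl) (i : fibre_index B) := Character {
  ch_fun :> B -> Prop;
  ch_dom : forall x, ch_fun x -> bot_of x = i;
  ch_add : forall x y, bot_of x = i -> bot_of y = i ->
    ch_fun (x + y) <-> ch_fun x \/ ch_fun y;
  ch_neg : forall x, bot_of x = i -> ch_fun (- x) <-> ~ ch_fun x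
}.

Section Character.
Variables (B : ibsl) (i : fibre_index B).
Implicit Types (h : character i) (x y : B).

Lemma character_ext h h' :
  (forall x, bot_of x = i -> h x <-> h' x) -> h = h'.
Proof.
case: h h' => [h d a n] [h' d' a' n'] /= hh'.
have E : h = h'.
  apply: funext => x; apply: propext.
  by split=> hx; apply/hh' => //; [apply: d|apply: d'].
case: _ / E in d' a' n' hh' *.
by congr Character; exact: Prop_irrelevance.
Qed.

Lemma ch_mul h x y : bot_of x = i -> bot_of y = i -> h (x * y) <-> h x /\ h y.
Proof.
move=> bx by_; rewrite ib_mulE ch_neg ?ch_add ?ch_neg ?bot_of_neg //.
  split=> [nn|]; last by tauto.
  by split; apply: contrapT; tauto.
by rewrite bot_of_add !bot_of_neg bx by_ ib_addxx.
Qed.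

Lemma ch_bot h : ~ h i.
Proof.
have bi := fi_botE i; have := ch_mul h bi (etrans (bot_of_neg i) bi).
by rewrite -/(bot_of i) bi ch_neg //; tauto.
Qed.

(** An inclusion between ultrafilters is an equality, by passing to complements; so the separating
    element can be taken in [h]. *)
Lemma ch_sep h h' : h <> h' -> exists x, [/\ bot_of x = i, h x & ~ h' x].
Proof.
move=> hh'; apply: contrapT => nx; apply: hh'; apply: character_ext => x bx.
have le y : bot_of y = i -> h y -> h' y.
  by move=> yi hy; apply: contrapT => h'y; apply: nx; exists y.
split; first exact: le.
move=> h'x; apply: contrapT => /(ch_neg _ bx)/le.
by rewrite bot_of_neg bx ch_neg // => /(_ erefl).
Qed.

(* A maximal multiplicatively closed subset of the fibre that never meets [a]
   in the bottom element is an ultrafilter containing [a]. *)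
Lemma character_exists (a : B) : bot_of a = i -> a <> i ->
  exists h : character i, h a.
Proof.
move=> ba ai.
pose P (F : set B) := [/\ forall x, F x -> bot_of x = i,
  forall x y, F x -> F y -> F (x * y) & forall x, F x -> x * a <> i].
have [|M [[Mi MM Ma] maxM]] := @Zorn_bigcup B P.
  move=> S SP tS; split.
  - by move=> x [F /SP[+ _ _] Fx]; exact.
  - move=> x y [F SF Fx] [G SG Gy].
    have [FG|GF] := tS _ _ SF SG.
      by exists G => //; have [_ + _] := SP _ SG; apply=> //; exact: FG.
    by exists F => //; have [_ + _] := SP _ SF; apply=> //; exact: GF.
  - by move=> x [F /SP[_ _ +] Fx]; exact.
have ibot x : bot_of x = i -> (i : B) * x = i.
  by move=> <-; rewrite ib_mulC mul_bot_of.
have Mni : ~ M i by move=> /Ma; rewrite ibot.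
(* By maximality, adjoining [c] and its multiples must produce an element meeting [a] in the bottom.
   As [M] is not yet known to be nonempty, [c] is adjoined separately from the products [m * c]. *)
have out c : bot_of c = i -> ~ M c -> c * a = i \/ exists2 m, M m & m * c * a = i.
  move=> bc nMc; apply: contrapT => nout.
  apply: (maxM (M `|` [set c] `|` [set m * c | m in M])).
    split; first by move=> x Mx; left; left.
    by move=> /(_ c) h; apply/nMc/h; left; right.
  split.
  - move=> x [[/Mi //|->//]|[m /Mi bm <-]].
    by rewrite bot_of_mul bm bc ib_addxx.
  - move=> x y [[Mx|->]|[m Mm <-]] [[My|->]|[n Mn <-]].
    + by left; left; exact: MM.
    + by right; exists x.
    + by right; exists (x * n); [exact: MM|rewrite ib_mulA].
    + by right; exists y; rewrite // ib_mulC.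
    + by left; right; rewrite /= ib_mulxx.
    + by right; exists n; rewrite // [c * _]ib_mulC -ib_mulA ib_mulxx.
    + right; exists (m * y); first exact: MM.
      by rewrite -!ib_mulA [y * c]ib_mulC.
    + by right; exists m; rewrite // -ib_mulA ib_mulxx.
    + right; exists (m * n); first exact: MM.
      by rewrite -!ib_mulA [c * (n * c)]ib_mulC -ib_mulA ib_mulxx.
  - move=> x [[/Ma //|->]|[m Mm <-]] E; apply: nout; first by left.
    by right; exists m.
have {}Maa : M a.
  apply: contrapT => /(out _ ba); rewrite ib_mulxx => -[//|[m Mm]].
  by rewrite -ib_mulA ib_mulxx; exact: Ma.
(* Once [a] belongs to [M], it can be absorbed into the witness. *)
have {}out c : bot_of c = i -> ~ M c -> exists2 n, M n & n * c = i.
  move=> bc /(out _ bc)[E|[m Mm E]]; first by exists a; rewrite // ib_mulC.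
  exists (m * a); first exact: MM.
  by rewrite -ib_mulA [a * c]ib_mulC ib_mulA.
have Mneg x : bot_of x = i -> M (- x) <-> ~ M x.
  move=> bx; split=> [Mnx Mx|nMx].
    by apply: Mni; rewrite -bx; exact: MM.
  apply: contrapT => nMnx.
  have [n Mn nx] := out _ bx nMx.
  have [m Mm mnx] := out (- x) (etrans (bot_of_neg x) bx) nMnx.
  have bn := Mi _ Mn; apply: Mni.
  (* Since [n] is disjoint from [x] it lies below [- x], which is disjoint from [m]. *)
  have <- : n * m = i; last exact: MM.
  rewrite -(@fibre_disjoint _ n x) ?bn // -ib_mulA [- x * m]ib_mulC mnx.
  by rewrite ib_mulC ibot.
have Madd x y : bot_of x = i -> bot_of y = i -> M (x + y) <-> M x \/ M y.
  move=> bx by_; split=> [Mxy|].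
    apply: contrapT => nor.
    have Mnx : M (- x) by apply/Mneg => // ?; apply: nor; left.
    have Mny : M (- y) by apply/Mneg => // ?; apply: nor; right.
    have := MM _ _ Mnx Mny; rewrite -ib_negD Mneg //.
    by rewrite bot_of_add bx by_ ib_addxx.
  have up u v : bot_of u = i -> bot_of v = i -> M u -> M (u + v).
    move=> bu bv Mu; apply: contrapT => /out[|n Mn E].
      by rewrite bot_of_add bu bv ib_addxx.
    apply: Mni; have <- : n * u = i; last exact: MM.
    rewrite -(@fibre_mul_add _ u v) ?bu ?bv // [u * _]ib_mulC ib_mulA E.
    exact: ibot.
  by move=> [|] ?; [|rewrite ib_addC]; apply: up.
by exists (Character Mi Madd Mneg).
Qed.

(** If every character containing [u] contains [v], then [u * - v] is the bottom, since otherwise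
    [character_exists] yields a character containing it. So [u] lies below [v], and antisymmetry
    concludes. *)
Lemma character_inj x y : bot_of x = i -> bot_of y = i ->
  (forall h, h x <-> h y) -> x = y.
Proof.
have le u v : bot_of u = i -> bot_of v = i -> (forall h, h u -> h v) -> u * v = u.
  move=> bu bv huv; rewrite -{1}[v]ib_negK; apply: fibre_disjoint.
  rewrite bu; apply: contrapT => /character_exists[|h].
    by rewrite bot_of_mul bot_of_neg bu bv ib_addxx.
  by rewrite ch_mul ?ch_neg ?bot_of_neg // => -[/huv].
move=> bx by_ hxy; rewrite -[LHS](le x y) // => [|h /hxy //].
by rewrite ib_mulC; apply: le => // h /hxy.
Qed.

End Character.

HB.instance Definition _ (B : ibsl) (i : fibre_index B) :=
  gen_eqMixin (character i).
HB.instance Definition _ (B : ibsl) (i : fibre_index B) :=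
  gen_choiceMixin (character i).

(** * The Stone space of a fibre *)

Section CharacterTopology.
Variables (B : ibsl) (i : fibre_index B).
Implicit Types (h : character i) (x y b : B).

Definition basic b : set (character i) := [set h | h b].

Definition character_op (U : set (character i)) :=
  forall h, U h -> exists b, [/\ bot_of b = i, h b & basic b `<=` U].

Lemma character_opT : character_op setT.
Proof.
(* [- i] is the top of the fibre, so it belongs to every character. *)
move=> h _; exists (- (i : B)); split=> //; first by rewrite bot_of_neg fi_botE.
by apply/ch_neg; [exact: fi_botE|exact: ch_bot].
Qed.

Lemma character_opI : setI_closed character_op.
Proof.
move=> U V oU oV h [/oU[b [bb hb bU]] /oV[c [bc hc cV]]].
exists (b * c); split; first by rewrite bot_of_mul bb bc ib_addxx.
  exact/ch_mul.
by move=> h' /(ch_mul _ bb bc)[]; split; [exact: bU|exact: cV].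
Qed.

Lemma character_op_bigU (J : Type) (f : J -> set (character i)) :
  (forall j, character_op (f j)) -> character_op (\bigcup_j f j).
Proof.
move=> of_ h [j _ /of_[b [bb hb bf]]]; exists b; split=> // h' /bf.
by exists j.
Qed.

HB.instance Definition _ := isOpenTopological.Build (character i)
  character_opT character_opI character_op_bigU.

Lemma openPbasic (U : set (character i)) : open U <-> character_op U.
Proof. by []. Qed.

Lemma basicC b : bot_of b = i -> ~` basic b = basic (- b).
Proof. by move=> bb; apply/seteqP; split=> h /(ch_neg _ bb). Qed.

Lemma basicU b c : bot_of b = i -> bot_of c = i ->
  basic (b + c) = basic b `|` basic c.
Proof. by move=> bb bc; apply/seteqP; split=> h /(ch_add _ bb bc). Qed.

Lemma clopen_basic b : bot_of b = i -> clopen (basic b).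
Proof.
have o c : bot_of c = i -> open (basic c).
  by move=> bc; apply/openPbasic => h hc; exists c; split.
move=> bb; split; first exact: o.
rewrite -[basic b]setCK basicC //; apply: open_closedC; apply: o.
by rewrite bot_of_neg.
Qed.

(** An ultrafilter [F] on the space converges to the character formed by the [x] in the fibre with
    [basic x] in [F]. *)
Lemma character_compact : compact [set: character i].
Proof.
rewrite compact_ultra => F UF _; have PF : ProperFilter F by exact: ultra_proper.
pose h x := bot_of x = i /\ F (basic x).
have h_dom x : h x -> bot_of x = i by case.
have h_neg x : bot_of x = i -> h (- x) <-> ~ h x.
  move=> bx; rewrite /h -basicC // bot_of_neg; split.
    move=> [_ FnU] [_ FU].
    by apply: (@filter_not_empty _ F PF); rewrite -(setICr (basic x)); exact: filterI.
  by move=> nh; split=> //; have [FU|//] := in_ultra_setVsetC (basic x) UF; case: nh.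
have h_add x y : bot_of x = i -> bot_of y = i -> h (x + y) <-> h x \/ h y.
  move=> bx by_; rewrite /h basicU // bot_of_add bx by_ ib_addxx; split.
    move=> [_ FU]; have [?|Fnx] := in_ultra_setVsetC (basic x) UF; first by left.
    right; split=> //; apply: filterS (filterI FU Fnx) => z [[//|//]].
  by move=> [[_ FU]|[_ FU]]; split=> //; apply: filterS FU => z ?; [left|right].
exists (Character h_dom h_add h_neg); split=> // U.
rewrite nbhsE => -[V [/openPbasic oV /oV[b [_ [_ Fb] bV]] VU]].
by apply: filterS Fb => z /bV /VU.
Qed.

Lemma character_zero_dimensional : zero_dimensional (character i).
Proof.
move=> h h' /eqP/ch_sep[b [bb hb h'b]].
by exists (basic b); split=> //; exact: clopen_basic.
Qed.

Lemma character_hausdorff : hausdorff_space (character i).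
Proof.
move=> h h' cl; apply: contrapT => /ch_sep[b [bb hb h'b]].
have [ob cb] := clopen_basic bb.
have [] := cl (basic b) (~` basic b).
- by apply: open_nbhs_nbhs.
- by apply: open_nbhs_nbhs; split=> //; exact: closed_openC.
- by move=> z [].
Qed.

Definition character_space : stoneSpace := StoneSpace character_compact
  character_hausdorff (zero_dimension_totally_disconnected
    character_zero_dimensional).

(** If [U] is not basic, removing from it the basic sets it contains gives a directed family of
    nonempty closed sets. A common point lies in [U] but in no basic subset of [U], against
    openness. *)
Lemma clopen_is_basic (U : set (character i)) :
  clopen U -> exists2 b, bot_of b = i & U = basic b.
Proof.
move=> [/openPbasic oU cU]; apply: contrapT => nb.
have [||||h hh] := @compact_directed_bigcap (character i)
  [set K | exists b, [/\ bot_of b = i, basic b `<=` U & K = U `\` basic b]].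
- exact: character_compact.
- exists (U `\` basic i), i; split=> //; first exact: fi_botE.
  by move=> h /ch_bot.
- move=> _ [b [bb bU ->]]; split.
    by apply: closedI => //; apply: open_closedC; case: (clopen_basic bb).
  apply: contrapT => nK; apply: nb; exists b => //.
  apply/seteqP; split=> // h Uh; apply: contrapT => nhb.
  by apply: nK; exists h.
- move=> _ _ [b [bb bU ->]] [c [bc cU' ->]].
  exists (U `\` basic (b + c)).
    exists (b + c); split=> //; first by rewrite bot_of_add bb bc ib_addxx.
    by rewrite basicU // => h [/bU|/cU'].
  by rewrite basicU // => h [Uh nh]; split; split=> // ?; apply: nh; [left|right].
have [Uh _] : (U `\` basic i) h.
  by apply: hh; exists i; split=> //; [exact: fi_botE|move=> h' /ch_bot].
have [b [bb hb bU]] := oU _ Uh.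
by have [_] : (U `\` basic b) h by apply: hh; exists b.
Qed.

End CharacterTopology.

(** * Restriction of characters and the representing inverse system *)

Section CharacterRestriction.
Variables (B : ibsl) (i j : fibre_index B) (le_ij : (i <= j)%O).
Implicit Type h : character j.

Let bot_addj x : bot_of x = i -> bot_of (x + j) = j.
Proof. by move=> bx; rewrite bot_of_add bx fi_botE (fi_leP le_ij). Qed.

(** The Stone dual of the fibre homomorphism adding [j]; the first conjunct enforces [ch_dom]. *)
Let rfun h x := bot_of x = i /\ h (x + j).

Let rfun_dom h x : rfun h x -> bot_of x = i.
Proof. by case. Qed.

Let rfun_add h x y : bot_of x = i -> bot_of y = i ->
  rfun h (x + y) <-> rfun h x \/ rfun h y.
Proof.
move=> bx by_; rewrite /rfun bot_of_add bx by_ ib_addxx.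
have -> : x + y + j = (x + j) + (y + j).
  by rewrite -!ib_addA [j + (y + j)]ib_addC -ib_addA ib_addxx.
by rewrite ch_add ?bot_addj //; tauto.
Qed.

Let rfun_neg h x : bot_of x = i -> rfun h (- x) <-> ~ rfun h x.
Proof.
move=> bx; rewrite /rfun bot_of_neg bx -(mul_neg_bot _ (fi_botE j)) -ib_negD.
by rewrite ch_neg ?bot_addj //; tauto.
Qed.

Definition restrict h : character i :=
  Character (@rfun_dom h) (@rfun_add h) (@rfun_neg h).

Lemma restrictE h x : bot_of x = i -> restrict h x <-> h (x + j).
Proof. by move=> bx; rewrite /= /rfun; tauto. Qed.

Lemma restrict_continuous : continuous restrict.
Proof.
apply/continuousP => U /openPbasic oU; apply/openPbasic => h /oU.
move=> [b [bb [_ hb] bU]]; exists (b + j); split=> //; first exact: bot_addj.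
by move=> h' h'b; apply: bU.
Qed.

Definition restrict_hom : @hom SA (character_space j) (character_space i) :=
  mkcts restrict_continuous.

End CharacterRestriction.

Section CharacterSystem.
Variable B : ibsl.

Lemma restrict_hom_id (i : fibre_index B) (le_ii : (i <= i)%O) :
  restrict_hom le_ii = idm (character_space i : SA).
Proof.
apply: app_ext => h; apply: character_ext => x bx.
rewrite -[app _ h]/(restrict le_ii h) restrictE //.
by rewrite -bx add_bot_of.
Qed.

Lemma restrict_hom_comp (i j k : fibre_index B)
    (le1 : (i <= j)%O) (le2 : (j <= k)%O) (le3 : (i <= k)%O) :
  restrict_hom le1 \oc restrict_hom le2 = restrict_hom le3.
Proof.
apply: app_ext => h; apply: character_ext => x bx.
rewrite -[app _ h]/(restrict le1 (restrict le2 h)).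
rewrite -[app (restrict_hom le3) h]/(restrict le3 h).
rewrite !restrictE //; last by rewrite bot_of_add bx fi_botE (fi_leP le1).
by rewrite -ib_addA (fi_leP le2).
Qed.

Definition character_system : inverse_system SA :=
  @InverseSystem SA (fibre_index B) (fun i => character_space i)
    (@restrict_hom B) restrict_hom_id restrict_hom_comp.

Definition index_of (b : B) : fibre_index B := FibreIndex (bot_ofK b).

Definition represent (b : B) : clopen_elt character_system :=
  @ClopenElt character_system (index_of b) (basic (i := index_of b) b)
    (clopen_basic (i := index_of b) erefl).

(** Pulling the clopen set of [b] back to a higher fibre matches moving [b] there, so sums can be
    compared inside one fibre. *)
Lemma res_represent (b : B) (k : fibre_index B) (h : character k) :
  (index_of b <= k)%O ->
  res (represent b) (h : pt character_system k) <-> h (b + k).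
Proof.
move=> le; rewrite (resE (a := represent b) (k := k) le).
exact: (@restrictE B (index_of b) k le h b erefl).
Qed.

Lemma represent_add b c : represent (b + c) = ce_add (represent b) (represent c).
Proof.
apply: clopen_elt_ext => /= [|h].
  by apply: fibre_index_inj; exact: bot_of_add.
have E : index_of (b + c) = (index_of b `|` index_of c)%O.
  by apply: fibre_index_inj; exact: bot_of_add.
have lb : (index_of b <= index_of (b + c))%O by rewrite E leUl.
have lc : (index_of c <= index_of (b + c))%O by rewrite E leUr.
rewrite res_add /=; last by rewrite leUx lb lc.
rewrite !res_represent //.
have bk x : (index_of x <= index_of (b + c))%O ->
    bot_of (x + index_of (b + c)) = index_of (b + c).
  by move=> le; rewrite bot_of_add bot_ofK; exact: (fi_leP le).
rewrite -ch_add ?bk //.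
have -> // : b + c + index_of (b + c) =
  b + index_of (b + c) + (c + index_of (b + c)).
by rewrite -!ib_addA; congr (_ + _); rewrite [RHS]ib_addC -ib_addA ib_addxx.
Qed.

Lemma represent_neg b : represent (- b) = ce_neg (represent b).
Proof.
have E : index_of (- b) = index_of b.
  by apply: fibre_index_inj; exact: bot_of_neg.
apply: clopen_elt_ext => //= h.
rewrite res_neg /= -?E // !res_represent // -?E //.
have addb x : index_of x = index_of (- b) -> x + index_of (- b) = x.
  by move=> <-; exact: add_bot_of.
by rewrite !addb // ch_neg // E.
Qed.

Lemma represent_zero : represent ib_zero = ce_bot character_system \bot%O.
Proof.
have E : index_of ib_zero = \bot%O.
  by apply: fibre_index_inj; exact: bot_of_zero.
apply: clopen_elt_ext => //= h; split=> [|/res_bot//].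
rewrite res_represent // ib_add0x => /ch_bot; exact.
Qed.

Definition represent_hom : ibsl_hom B (clopen_algebra character_system) :=
  @ibsl_hom_of_add_neg B (clopen_algebra character_system) represent
    represent_add represent_neg represent_zero.

Lemma represent_inj : injective represent.
Proof.
move=> b c bc; have E : index_of b = index_of c.
  exact: (congr1 (@ce_index character_system) bc).
have Eb : bot_of c = index_of b by rewrite E.
apply: (@character_inj B (index_of b)) => // h.
have addb x : bot_of x = index_of b -> x + index_of b = x.
  by move=> <-; exact: add_bot_of.
have := res_represent h (lexx (index_of b)); rewrite bc res_represent ?E //.
by rewrite !addb // => ->.
Qed.

Lemma represent_surj (a : clopen_elt character_system) : exists b, represent b = a.
Proof.
case: a => i U cU; have [b bb Ub] := clopen_is_basic cU; exists b.
have E : index_of b = i by exact: fibre_index_inj.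
case: _ / E in U cU bb Ub *.
by apply: clopen_elt_ext => //= h; rewrite !res_id /= Ub.
Qed.

End CharacterSystem.

Theorem theorem4p8 : dually_equivalent (Sem_inv SA) IBSL.
Proof.
apply: (@dually_equivalent_fully_faithful _ _ clopen_functor).
- exact: clopen_functor_faithful.
- exact: clopen_functor_full.
move=> B; exists (character_system B).
have [u [ru ur]] :=
  ibsl_bij_iso (@represent_inj B : injective (represent_hom B))
    (@represent_surj B).
by exists u, (represent_hom B).
Qed.
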